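(* Let $x_0\sim p_{\mathrm{data}}$ be an integrable random vector in $\mathbb R^d$, let $\varepsilon\sim\mathcal N(0,I_d)$ be independent of $x_0$, and let $x_t=\alpha_t x_0+\sigma_t\varepsilon$ with $t\in[0,1]$ and $\alpha_t\neq 0$. Consider the problem of maximizing, over measurable maps $\hat x:\mathbb R^d\to\mathbb R^d$, the welfare $$W(\hat x)=-\mathbb E\bigl[\|x_0-\hat x(x_t)\|^2\bigr],$$ equivalently of minimizing $\mathbb E\|x_0-\hat x(x_t)\|^2$. The unique solution (up to almost sure equality) of this problem is $$\hat x^\star(x_t)=\mathbb E[x_0\mid x_t].$$
   Context: The law $p_{\mathrm{data}}$ on $\mathbb R^d$ is otherwise arbitrary (unknown). The deterministic scalars $\alpha_t,\sigma_t$, $t\in[0,1]$, form a variance-preserving diffusion noise schedule with $\alpha_0=1$, $\sigma_0=0$, and $\alpha_1\approx 0$, $\sigma_1\approx 1$. $\|\cdot\|$ is the Euclidean norm. The planner observes only $x_t$ and chooses a reconstruction $\hat x(x_t)$ of $x_0$. *)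

(* Defs.v *)
From HB Require Import structures.
From mathcomp Require Export all_boot all_order all_algebra.
From mathcomp Require Export all_classical all_reals all_analysis.

Set Implicit Arguments.
Unset Strict Implicit.
Unset Printing Implicit Defensive.

Import Order.TTheory GRing.Theory Num.Theory.

Local Open Scope classical_set_scope.
Local Open Scope ring_scope.

(* R^d is [d.-tuple R], whose library sigma-algebra is the product of the Borel
   sigma-algebras of the coordinates, i.e. the Borel sigma-algebra of R^d.
   The library puts no vector space structure on tuples, hence the two
   operations below. *)

Definition vec_sub (R : realType) (d : nat) (x y : d.-tuple R) : d.-tuple R :=
  [tuple tnth x i - tnth y i | i < d].

Definition vec_comb (R : realType) (d : nat)
    (a : R) (x : d.-tuple R) (b : R) (y : d.-tuple R) : d.-tuple R :=
  [tuple a * tnth x i + b * tnth y i | i < d].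

Definition enorm (R : realType) (d : nat) (x : d.-tuple R) : R :=
  Num.sqrt (\sum_(i < d) tnth x i ^+ 2).

(* The boundary values at time 1 are only prescribed approximately
   (alpha_1 ~ 0 and sigma_1 ~ 1); delta is the tolerance. *)
Record vp_schedule (R : realType) (delta : R) (alpha sigma : R -> R) : Prop :=
  VPSchedule {
    vp_preserving : forall t, 0 <= t <= 1 -> alpha t ^+ 2 + sigma t ^+ 2 = 1;
    vp_alpha0 : alpha 0 = 1;
    vp_sigma0 : sigma 0 = 0;
    vp_alpha1 : `|alpha 1| <= delta;
    vp_sigma1 : `|sigma 1 - 1| <= delta }.

Definition has_law (disp disp' : measure_display) (T : measurableType disp)
    (E : measurableType disp') (R : realType) (P : probability T R)
    (X : {RV P >-> E}) (mu : probability E R) : Prop :=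
  forall A : set E, measurable A -> distribution P X A = mu A.

(* N(0, I_d) is the d-fold product of N(0, 1), which is determined by its
   values on measurable rectangles. *)
Definition has_std_gaussian_law (disp : measure_display)
    (T : measurableType disp) (R : realType) (P : probability T R) (d : nat)
    (X : {RV P >-> d.-tuple R}) : Prop :=
  forall B : 'I_d -> set R, (forall i, measurable (B i)) ->
    distribution P X [set x : d.-tuple R | forall i, B i (tnth x i)]
    = (\prod_(i < d) normal_prob 0%R 1%R (B i))%E.

Definition independent_RV (disp disp1 disp2 : measure_display)
    (T : measurableType disp) (E1 : measurableType disp1)
    (E2 : measurableType disp2) (R : realType) (P : probability T R)
    (X : {RV P >-> E1}) (Y : {RV P >-> E2}) : Prop :=
  forall (A : set E1) (B : set E2), measurable A -> measurable B ->
    P (X @^-1` A `&` Y @^-1` B) = (P (X @^-1` A) * P (Y @^-1` B))%E.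

Definition integrable_vec (disp : measure_display) (T : measurableType disp)
    (R : realType) (P : probability T R) (d : nat) (X : T -> d.-tuple R) : Prop :=
  P.-integrable setT (fun w => (enorm (X w))%:E).

(* Y is a version of E[X | Z], in Kolmogorov's sense; the vector integrals are
   taken coordinatewise. *)
Record is_cond_expectation (disp disp' : measure_display)
    (T : measurableType disp) (E : measurableType disp') (R : realType)
    (P : probability T R) (d : nat)
    (X : T -> d.-tuple R) (Z : T -> E) (Y : T -> d.-tuple R) : Prop :=
  IsCondExpectation {
    cond_exp_measurable : forall B : set (d.-tuple R), measurable B ->
      g_sigma_algebra_preimage Z (Y @^-1` B);
    cond_exp_integrable : integrable_vec P Y;
    cond_exp_integral : forall A : set T, g_sigma_algebra_preimage Z A ->
      forall i : 'I_d,
        (\int[P]_(w in A) (tnth (Y w) i)%:E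
         = \int[P]_(w in A) (tnth (X w) i)%:E)%E }.

Definition mse (disp : measure_display) (T : measurableType disp)
    (R : realType) (P : probability T R) (d : nat) (x0 xt : T -> d.-tuple R)
    (xhat : {mfun d.-tuple R >-> d.-tuple R}) : \bar R :=
  ('E_P[fun w => (enorm (vec_sub (x0 w) (xhat (xt w))) ^+ 2)%R])%E.

Definition welfare (disp : measure_display) (T : measurableType disp)
    (R : realType) (P : probability T R) (d : nat) (x0 xt : T -> d.-tuple R)
    (xhat : {mfun d.-tuple R >-> d.-tuple R}) : \bar R :=
  (- mse P x0 xt xhat)%E.

Definition maximizes (S : Type) (R : realType) (F : S -> \bar R) (s : S) : Prop :=
  forall s', (F s' <= F s)%E.

Definition minimizes (S : Type) (R : realType) (F : S -> \bar R) (s : S) : Prop :=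
  forall s', (F s <= F s')%E.

(* Main.v *)
(* For e integrable with zero integral over every event of Z, e is orthogonal to
   every bounded function of Z, whence
     E (e - h(Z))^2 = E e^2 + E h(Z)^2   in [0, +oo]
   for every measurable h: the identity holds on {|h(Z)| <= n}, and n tends to
   infinity. With e = x0 - E[x0 | xt], coordinatewise,
     mse(xhat) = mse(E[x0 | xt]) + E |xhat(xt) - E[x0 | xt]|^2.
   Since x0 is only integrable, both sides could be infinite; they are not for the
   linear reconstruction xt / alpha_t, whose error is the Gaussian vector
   - (sigma_t / alpha_t) eps. Hence mse(E[x0 | xt]) is finite, it is the minimum,
   and it is attained only by maps that agree with E[x0 | xt] almost surely. *)
From HB Require Import structures.
Require Import Defs.
From mathcomp Require Import all_boot all_order all_algebra finmap.
From mathcomp Require Import all_classical all_reals all_analysis.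
From mathcomp Require Import measurable_realfun.
From mathcomp Require Import ring lra.

Set Implicit Arguments.
Unset Strict Implicit.
Unset Printing Implicit Defensive.

Import Order.TTheory GRing.Theory Num.Theory.
Import HBNNSimple.

Local Open Scope classical_set_scope.
Local Open Scope ring_scope.

(** * Orthogonality of [e] to bounded functions of [Z] *)

Section orthogonality.
Local Open Scope ereal_scope.
Context d d' (T : measurableType d) (E : measurableType d') (R : realType).
Variables (mu : {measure set T -> \bar R}) (Z : T -> E) (e : T -> R).
Hypotheses (mZ : measurable_fun setT Z)
  (ie : mu.-integrable setT (fun w => (e w)%:E)).
Hypothesis e0 : forall B, measurable B -> \int[mu]_(w in Z @^-1` B) (e w)%:E = 0.

Let mZB B : measurable B -> measurable (Z @^-1` B).
Proof. by move=> mB; rewrite -[_ @^-1` _]setTI; exact: mZ. Qed.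

(** A simple function takes finitely many values [r], so the integrand is a finite sum of terms
    [r * e] restricted to the events where [f (Z w) = r]. Each such event is a preimage under [Z],
    and [e0] applies to it. *)
Lemma integral_nnsfun_comp_mul0 (f : {nnsfun E >-> R}) :
  \int[mu]_w (f (Z w) * e w)%:E = 0.
Proof.
pose S r := Z @^-1` (f @^-1` [set r]).
pose eS r := (fun w => (e w)%:E) \_ (S r).
pose g r w : \bar R := (r * \1_(S r) w)%:E * (e w)%:E.
have mS r : measurable (S r) by exact: mZB.
have gE r w : g r w = r%:E * eS r w.
  by rewrite /g /eS epatch_indic/= EFinM -muleA [X in _ * X = _]muleC.
have ig r : mu.-integrable setT (eS r).
  apply/(integrable_mkcond _ (mS r)).
  exact: (integrableS measurableT (mS r) (@subsetT _ _) ie).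
transitivity (\int[mu]_w (\sum_(r <- fset_set (range f)) g r w)).
  apply: eq_integral => w _; rewrite fimfunE fsbig_finite//=.
  by rewrite mulr_suml -sumEFin; apply: eq_bigr.
rewrite integral_sum//; last first.
  move=> r; rewrite (_ : g r = fun w => r%:E * eS r w).
    exact: integrableZl.
  by apply/funext => w; exact: gE.
rewrite big1// => r _.
under eq_integral do rewrite gE.
by rewrite integralZl// -integral_mkcond/= e0// mule0.
Qed.

(** Adding [M] makes [h] nonnegative and bounded by [2 * M], so that increasing simple functions
    approximate it. Dominated convergence, with dominating function [2 * M * |e|], carries the
    simple case to the limit. The shift contributes only [M] times the total integral of [e], which
    vanishes by [e0] on the whole space. *)
Lemma integral_bounded_comp_mul0 (h : E -> R) (M : R) :
  measurable_fun setT h -> (forall x, `|h x| <= M)%R ->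
  \int[mu]_w (h (Z w) * e w)%:E = 0.
Proof.
move=> mh hM; pose k x := (h x + M)%R.
have k0 x : (0 <= k x)%R by have := hM x; rewrite ler_norml /k; lra.
have k2M x : (k x <= 2 * M)%R by have := hM x; rewrite ler_norml /k; lra.
pose F x := (k x)%:E.
have mk : measurable_fun setT F.
  by apply/measurable_EFinP; exact: measurable_funD.
have me := measurable_int _ ie.
have mkZ : measurable_fun setT (fun w => (k (Z w) * e w)%:E).
  apply/measurable_EFinP; apply: measurable_funM; last exact/measurable_EFinP.
  by apply: measurableT_comp => //; exact/measurable_EFinP.
pose a n : {nnsfun E >-> R} := nnsfun_approx measurableT mk n.
have ma n : measurable_fun setT (fun w => (a n (Z w) * e w)%:E).
  apply/measurable_EFinP; apply: measurable_funM; last exact/measurable_EFinP.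
  exact: measurableT_comp.
have ale n x : (a n x <= k x)%R.
  rewrite -lee_fin; have := @le_approx _ _ _ setT F n x.
  by rewrite /a nnsfun_approxE; apply => // y _; rewrite lee_fin.
have [] := @dominated_convergence _ _ _ mu setT measurableT
  (fun n w => (a n (Z w) * e w)%:E) (fun w => (k (Z w) * e w)%:E)
  (fun w => (2 * M)%:E * (`|e w|)%:E) ma mkZ.
- apply: aeW => w _.
  rewrite [X in X @ _ --> _](_ : _ = fun n => (a n (Z w))%:E * (e w)%:E)//.
  rewrite [X in _ --> X](_ : _ = F (Z w) * (e w)%:E)//.
  by apply: cvgeZr => //; apply: cvg_nnsfun_approx => // y _; rewrite lee_fin.
- by apply: integrableZl => //; exact: (integrable_abse ie).
- apply: aeW => w n _; rewrite /= -EFinM lee_fin normrM ler_wpM2r//.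
  by rewrite ger0_norm// (le_trans (ale _ _)).
move=> ik _ kcvg.
have k_0 : \int[mu]_w (k (Z w) * e w)%:E = 0.
  rewrite -(cvg_lim _ kcvg)//; apply/cvg_lim => //.
  under eq_fun do rewrite integral_nnsfun_comp_mul0.
  exact: cvg_cst.
transitivity (\int[mu]_w
    ((fun w => (k (Z w) * e w)%:E) \- (fun w => M%:E * (e w)%:E)) w).
  apply: eq_integral => w _.
  transitivity (k (Z w) * e w - M * e w)%:E => //.
  by congr EFin; rewrite /k; ring.
rewrite (integralB measurableT ik (integrableZl measurableT M ie)).
rewrite k_0 (integralZl measurableT ie).
by have := e0 measurableT; rewrite preimage_setT => ->; rewrite mule0 sube0.
Qed.

End orthogonality.

(** * The Pythagorean identity, with possibly infinite second moments *)

Lemma ge0_integralD_integrable d (T : measurableType d) (R : realType)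
    (mu : {measure set T -> \bar R}) (D : set T) (f g u : T -> R) :
  measurable D -> measurable_fun D f -> measurable_fun D g ->
  (forall x, D x -> 0 <= f x) -> (forall x, D x -> 0 <= g x) ->
  mu.-integrable D (fun x => (u x)%:E) -> (forall x, D x -> f x = g x + u x) ->
  (\int[mu]_(x in D) (f x)%:E =
   \int[mu]_(x in D) (g x)%:E + \int[mu]_(x in D) (u x)%:E)%E.
Proof.
move=> mD mf mg f0 g0 iu fgu; pose U x := (u x)%:E.
have mU : measurable_fun D U := measurable_int _ iu.
have fin_p : (\int[mu]_(x in D) U^\+ x)%E \is a fin_num.
  by apply: integrable_fin_num => //; exact: integrable_funepos.
have fin_n : (\int[mu]_(x in D) U^\- x)%E \is a fin_num.
  by apply: integrable_fin_num => //; exact: integrable_funeneg.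
rewrite [X in (_ + X)%E]integralE -/U addeA.
(* The integrals of [f] and [g] may be infinite. Moving the negative part of [u] to the side of [f]
   leaves only nonnegative functions, whose integrals add without any finiteness. The integrals of
   both parts of [u] are finite, so the move can be undone. *)
suff : (\int[mu]_(x in D) (f x)%:E + \int[mu]_(x in D) U^\- x =
        \int[mu]_(x in D) (g x)%:E + \int[mu]_(x in D) U^\+ x)%E.
  by move=> <-; rewrite addeK.
rewrite -!ge0_integralD//.
- apply: eq_integral => x /[1!inE] Dx.
  rewrite funeposE funenegE/= -!EFin_max -!EFinD.
  congr EFin; rewrite fgu// /Order.max; do 2 case: ifPn; lra.
- exact/measurable_EFinP.
- exact: measurable_funepos.
- exact/measurable_EFinP.
- exact: measurable_funeneg.
Qed.

Section pythagoras.
Local Open Scope ereal_scope.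
Context d d' (T : measurableType d) (E : measurableType d') (R : realType).
Variables (mu : {measure set T -> \bar R}) (Z : T -> E) (e : T -> R).
Hypotheses (mZ : measurable_fun setT Z)
  (ie : mu.-integrable setT (fun w => (e w)%:E)).
Hypothesis e0 : forall B, measurable B -> \int[mu]_(w in Z @^-1` B) (e w)%:E = 0.

Lemma integral_sqrB_comp (h : E -> R) : measurable_fun setT h ->
  \int[mu]_w ((e w - h (Z w)) ^+ 2)%:E =
  \int[mu]_w (e w ^+ 2)%:E + \int[mu]_w (h (Z w) ^+ 2)%:E.
Proof.
move=> mh; pose B n := [set x | (`|h x| <= n%:R)%R].
have mB n : measurable (B n).
  rewrite -[B n]setTI; apply: measurable_fun_le => //.
  exact: measurableT_comp.
pose A n := Z @^-1` B n.
have mA n : measurable (A n) by rewrite -[A n]setTI; exact: mZ.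
have ndA : nondecreasing_seq A.
  move=> m n mn; apply/subsetPset => w; rewrite /A /B /= => /le_trans; apply.
  by rewrite ler_nat.
have UA : \bigcup_n A n = setT.
  apply/seteqP; split=> // w _; exists (Num.truncn `|h (Z w)|).+1 => //.
  by rewrite /A /B /=; exact/ltW/truncnS_gt.
have me : measurable_fun setT e.
  by apply/measurable_EFinP; exact: measurable_int ie.
have mhZ : measurable_fun setT (h \o Z) by exact: measurableT_comp.
have m1 : measurable_fun setT (fun w => (e w - h (Z w)) ^+ 2)%R.
  by apply: measurable_funX; exact: measurable_funB.
have m2 : measurable_fun setT (fun w => e w ^+ 2)%R by exact: measurable_funX.
have m3 : measurable_fun setT (fun w => h (Z w) ^+ 2)%R.
  exact: (measurable_funX 2 mhZ).
have cvgA (f : T -> R) : measurable_fun setT f -> (forall w, (0 <= f w)%R) ->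
    \int[mu]_(w in A n) (f w)%:E @[n --> \oo] --> \int[mu]_w (f w)%:E.
  move=> mf f0; rewrite -UA; apply: ge0_nondecreasing_set_cvg_integral => //.
    by move=> n; apply/measurable_funTS/measurable_EFinP.
  by move=> n w _; rewrite lee_fin.
(* This is the cross term of the expanded square. On [A n] the factor [h (Z w)] is bounded, which
   makes the term integrable even when [e] is not square-integrable. *)
have orth n : mu.-integrable (A n) (fun w => (- 2 * (h (Z w) * e w))%:E) /\
    \int[mu]_(w in A n) (- 2 * (h (Z w) * e w))%:E = 0.
  (* The cutoff is absorbed into a bounded function on [E]: [k (Z w) * e w] is the cross term
     extended by zero outside [A n], and the orthogonality lemma applies to it on the whole
     space. *)
  pose k x := (- 2 * (h x * \1_(B n) x))%R.
  have mk : measurable_fun setT k.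
    by apply: measurable_funM => //; exact: measurable_funM.
  have kM x : (`|k x| <= 2 * n%:R)%R.
    rewrite /k normrM normrN normr_nat ler_wpM2l// indicE.
    have [/[1!inE] xB|xB] := boolP (x \in B n); first by rewrite mulr1.
    by rewrite mulr0 normr0.
  have kE w : A n w -> (k (Z w) * e w = - 2 * (h (Z w) * e w))%R.
    by move=> Aw; rewrite /k indicE mem_set// mulr1 mulrA.
  have keE : (fun w => (k (Z w) * e w)%:E) =
      (fun w => (- 2 * (h (Z w) * e w))%:E) \_ (A n).
    apply/funext => w; rewrite patchE; case: ifPn => [/[1!inE] Aw|nAw].
      by rewrite kE.
    by rewrite /k indicE -[_ \in B n]/(w \in A n) (negbTE nAw) !(mulr0, mul0r).
  split.
    apply/(integrable_mkcond _ (mA n)); rewrite -keE.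
    apply: (@integrableMr _ _ _ mu setT measurableT (k \o Z) (EFin \o e)) => //.
      exact: measurableT_comp.
    exists (2 * n%:R)%R; split; first exact: num_real.
    by move=> x xM w _; rewrite /= (le_trans (kM _))// ltW.
  rewrite integral_mkcond -keE.
  exact: (integral_bounded_comp_mul0 mZ ie e0 mk kM).
have AE n : \int[mu]_(w in A n) ((e w - h (Z w)) ^+ 2)%:E =
    \int[mu]_(w in A n) (e w ^+ 2)%:E + \int[mu]_(w in A n) (h (Z w) ^+ 2)%:E.
  have [iu u0] := orth n.
  (* The cross term is the only one without a sign. It is split off as the integrable summand, since
     the integral of [e w ^+ 2] over [A n] may be infinite. *)
  rewrite (@ge0_integralD_integrable _ _ _ mu _ _
    (fun w => e w ^+ 2 + h (Z w) ^+ 2)%R _ (mA n) _ _ _ _ iu).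
  - rewrite u0 adde0; under eq_integral do rewrite EFinD.
    rewrite ge0_integralD//.
    + by move=> w _; rewrite lee_fin sqr_ge0.
    + exact/measurable_funTS/measurable_EFinP.
    + by move=> w _; rewrite lee_fin sqr_ge0.
    + exact/measurable_funTS/measurable_EFinP.
  - exact: measurable_funTS.
  - exact/measurable_funTS/measurable_funD.
  - by move=> w _; rewrite sqr_ge0.
  - by move=> w _; rewrite addr_ge0// sqr_ge0.
  - by move=> w _; ring.
have := cvgA _ m1 (fun w => sqr_ge0 _); under eq_fun do rewrite AE.
(* Both sides are limits along the increasing events [A n]. The two limits on the right are
   nonnegative, so their sum is never of the form [+oo - oo]. *)
move=> /cvg_lim <-//; apply/cvg_lim => //.
apply: cvgeD.
- by apply: ge0_adde_def; rewrite inE integral_ge0// => w _; rewrite lee_fin sqr_ge0.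
- by apply: cvgA => // w; exact: sqr_ge0.
- by apply: cvgA => // w; exact: sqr_ge0.
Qed.

End pythagoras.

(** * Existence of a conditional expectation that factors through [Z] *)

Section cond_exp.
Local Open Scope ereal_scope.
Context d d' (T : measurableType d) (E : measurableType d') (R : realType).
Variables (P : probability T R) (Z : {mfun T >-> E}).

Lemma cond_exp_factor_ex (X : T -> R) :
  P.-integrable setT (fun w => (X w)%:E) ->
  exists g : E -> R, [/\ measurable_fun setT g,
    P.-integrable setT (fun w => (g (Z w))%:E) &
    forall B, measurable B ->
      \int[P]_(w in Z @^-1` B) (g (Z w))%:E = \int[P]_(w in Z @^-1` B) (X w)%:E].
Proof.
move=> iX; have mZ : measurable_fun setT Z by [].
have mZB B : measurable B -> measurable (Z @^-1` B).
  by move=> mB; rewrite -[_ @^-1` _]setTI; exact: mZ.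
have [nu nuE] : exists nu : {charge set E -> \bar R},
    forall B, nu B = \int[P]_(w in Z @^-1` B) (X w)%:E.
  by unshelve eexists (pushforward (induced_charge iX) Z).
have numu : nu `<< distribution P Z.
  apply/null_content_dominatesP => A mA PA0; rewrite nuE.
  apply: null_set_integral => //; first exact: mZB.
  exact: measurable_funTS (measurable_int _ iX).
pose f := Radon_Nikodym nu (distribution P Z).
(* The derivative is extended-real valued but finite everywhere, so [fine] alters no value. *)
have ffin x : f x \is a fin_num by exact: Radon_Nikodym_fin_num.
have fi : (distribution P Z).-integrable setT f by exact: Radon_Nikodym_integrable.
have mf := measurable_int _ fi.
have fZ w : (fine (f (Z w)))%:E = f (Z w) by rewrite fineK.
have ifZ : P.-integrable setT (fun w => (fine (f (Z w)))%:E).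
  under eq_fun do rewrite fZ.
  apply/integrableP; split; first exact: measurableT_comp.
  case/integrableP : fi => _; rewrite ge0_integral_distribution//.
  exact: measurableT_comp.
exists (fine \o f); split=> //.
- exact: measurableT_comp.
- move=> B mB; rewrite -nuE.
  rewrite [RHS](Radon_Nikodym_integral numu mB) /=.
  rewrite [RHS]integral_pushforward//.
    by apply: eq_integral => w _; rewrite fineK.
  apply: integrableS measurableT _ _ _ => //; first exact: mZB.
  by move: ifZ; under eq_fun do rewrite fZ.
Qed.

End cond_exp.

(** * Second moment of the standard normal law *)

Lemma normal_prob01_sqr_lty (R : realType) :
  (\int[normal_prob (0 : R) 1]_x (x ^+ 2)%:E < +oo)%E.
Proof.
pose mu := @lebesgue_measure R; pose nu := normal_prob (0 : R) 1.
have numu : nu `<< mu := @normal_prob_dominates R 0 1.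
have msqr : measurable_fun setT (fun x : R => (x ^+ 2)%:E).
  by apply/measurable_EFinP; exact: measurable_funX.
rewrite -(Radon_Nikodym_SigmaFinite.change_of_variables numu)//; last first.
  by move=> x; rewrite lee_fin sqr_ge0.
(* The abstract density and the explicit one have the same integral over every measurable set, hence
   agree almost everywhere. *)
have pdfE : ae_eq mu setT (Radon_Nikodym_SigmaFinite.f nu mu)
    (fun x => (normal_pdf 0 1 x)%:E).
  apply: integral_ae_eq => //.
  - exact: Radon_Nikodym_SigmaFinite.f_integrable.
  - by apply/measurable_EFinP; exact: measurable_normal_pdf.
  - by move=> A _ mA; rewrite -Radon_Nikodym_SigmaFinite.f_integral.
have mpdf (s : R) : measurable_fun setT (fun x : R => (normal_pdf 0 s x)%:E).
  by apply/measurable_EFinP; exact: measurable_normal_pdf.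
pose g (x : R) : \bar R := ((x ^+ 2)%:E * (normal_pdf 0 1 x)%:E)%E.
rewrite [X in (X < _)%E](_ : _ = \int[mu]_x g x)%E; last first.
  apply: ae_eq_integral => //; last exact: ae_eqe_mul2l.
    apply: emeasurable_funM => //; apply: measurable_int.
    exact: Radon_Nikodym_SigmaFinite.f_integrable.
  by apply: emeasurable_funM => //; exact: mpdf.
(* From u <= exp u at u = 3 x^2 / 8. *)
pose c : R := 8 / 3 * normal_peak 1 / normal_peak 2.
have p1 : 0 < normal_peak (1 : R) by apply: normal_peak_gt0; rewrite oner_eq0.
have p2 : 0 < normal_peak (2 : R) by apply: normal_peak_gt0; rewrite pnatr_eq0.
have pdf_le x : x ^+ 2 * normal_pdf 0 1 x <= c * normal_pdf 0 2 x.
  rewrite !normal_pdfE ?oner_eq0 ?pnatr_eq0// /normal_fun !subr0.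
  rewrite (_ : c * _ = normal_peak 1 * (8 / 3 * expR (- x ^+ 2 / (2 ^+ 2 *+ 2)))).
    rewrite (mulrCA (x ^+ 2)) ler_pM2l//.
    rewrite (_ : - x ^+ 2 / (2 ^+ 2 *+ 2) =
      - x ^+ 2 / (1 ^+ 2 *+ 2) + 3 / 8 * x ^+ 2); last by field.
    rewrite expRD mulrCA mulrC ler_wpM2l ?expR_ge0//.
    by have := expR_ge1Dx (3 / 8 * x ^+ 2); lra.
  by rewrite /c; field; rewrite gt_eqF.
(* The dominating function is [c] times the normal density of standard deviation 2, so its integral
   is [c]. *)
apply: (@le_lt_trans _ _ (\int[mu]_x (c%:E * (normal_pdf 0 2 x)%:E))%E).
  apply: ge0_le_integral => //.
  - by move=> x _; rewrite /g -EFinM lee_fin mulr_ge0 ?sqr_ge0 ?normal_pdf_ge0.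
  - by apply: emeasurable_funM => //; exact: mpdf.
  - by apply: emeasurable_funM => //; exact: mpdf.
  - by move=> x _; rewrite /g -!EFinM lee_fin.
rewrite integralZl//; last exact: integrable_normal_pdf.
by rewrite integral_normal_pdf mule1 ltry.
Qed.

(** * Euclidean norm and coordinates *)

Section vectors.
Context d (T : measurableType d) (R : realType) (n : nat).
Implicit Types (X : T -> n.-tuple R) (x : n.-tuple R).

Lemma enorm_sqr x : enorm x ^+ 2 = \sum_(i < n) tnth x i ^+ 2.
Proof. by rewrite sqr_sqrtr// sumr_ge0// => i _; exact: sqr_ge0. Qed.

Lemma enorm_ge0 x : 0 <= enorm x. Proof. exact: sqrtr_ge0. Qed.

Lemma tnth_le_enorm x i : `|tnth x i| <= enorm x.
Proof.
rewrite -(@ler_pXn2r _ 2)// ?nnegrE ?enorm_ge0// enorm_sqr real_normK ?num_real//.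
by rewrite (bigD1 i)//= lerDl sumr_ge0// => j _; exact: sqr_ge0.
Qed.

Lemma enorm_le_sum x : enorm x <= \sum_(i < n) `|tnth x i|.
Proof.
have s0 : 0 <= \sum_(i < n) `|tnth x i| by rewrite sumr_ge0.
rewrite -(@ler_pXn2r _ 2)// ?nnegrE ?enorm_ge0// enorm_sqr [leRHS]expr2 mulr_suml.
apply: ler_sum => i _; rewrite -real_normK ?num_real// expr2 ler_wpM2l//.
by rewrite (bigD1 i)//= lerDl sumr_ge0.
Qed.

Lemma measurable_tnth_comp X (i : 'I_n) :
  measurable_fun setT X -> measurable_fun setT (fun w => tnth (X w) i).
Proof.
exact: (measurableT_comp (f := fun x : n.-tuple R => tnth x i) (measurable_tnth i)).
Qed.

(** The norm dominates each coordinate and is dominated by the sum of their absolute values. This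
    lets vector statements be proved one coordinate at a time. *)
Lemma integrable_vecP (P : probability T R) X : measurable_fun setT X ->
  integrable_vec P X <->
  forall i, P.-integrable setT (fun w => (tnth (X w) i)%:E).
Proof.
move=> mX; have mXi i : measurable_fun setT (fun w => tnth (X w) i).
  exact: measurable_tnth_comp.
split=> [iX i|iX].
- apply: le_integrable iX => //; first exact/measurable_EFinP.
  by move=> w _; rewrite lee_fin (ger0_norm (enorm_ge0 _)) tnth_le_enorm.
- have iS : P.-integrable setT (fun w => \sum_(i < n) `|(tnth (X w) i)%:E|)%E.
    by apply: integrable_sum => // i _; exact: integrable_abse.
  apply: le_integrable iS => //.
    apply/measurable_EFinP; rewrite /enorm; apply: measurableT_comp.
      exact: continuous_measurable_fun (@sqrt_continuous R).
    by apply: measurable_sum => i; exact: measurable_funX.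
  move=> w _; rewrite sumEFin lee_fin !ger0_norm ?sumr_ge0 ?enorm_ge0//.
  exact: enorm_le_sum.
Qed.

End vectors.

(** * Mean squared error and versions of the conditional expectation *)

Section mean_squared_error.
Local Open Scope ereal_scope.
Context d (T : measurableType d) (R : realType) (n : nat) (P : probability T R).
Variables (X : {RV P >-> n.-tuple R}) (Z : {RV P >-> n.-tuple R}).
Implicit Types f g : {mfun n.-tuple R >-> n.-tuple R}.

Lemma mseE f : mse P X Z f =
  \sum_(i < n) \int[P]_w ((tnth (X w) i - tnth (f (Z w)) i) ^+ 2)%:E.
Proof.
have mX i := measurable_tnth_comp i (measurable_funPT X).
have mf i := measurable_tnth_comp i
  (measurableT_comp (measurable_funPT f) (measurable_funPT Z)).
rewrite /mse unlock -ge0_integral_sum//.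
- apply: eq_integral => w _; rewrite sumEFin enorm_sqr; congr EFin.
  by apply: eq_bigr => i _; rewrite tnth_mktuple.
- by move=> i; apply/measurable_EFinP/measurable_funX/measurable_funB.
- by move=> i w _; rewrite lee_fin sqr_ge0.
Qed.

Lemma is_cond_expectationP f : is_cond_expectation P X Z (f \o Z) <->
  forall i, P.-integrable setT (fun w => (tnth (f (Z w)) i)%:E) /\
    forall B, measurable B ->
      \int[P]_(w in Z @^-1` B) (tnth (f (Z w)) i)%:E =
      \int[P]_(w in Z @^-1` B) (tnth (X w) i)%:E.
Proof.
have mfZ : measurable_fun setT (f \o Z) by exact: measurableT_comp.
split=> [[_ /(integrable_vecP _ mfZ) ifZ fZE] i|fZE].
  by split=> // B mB; apply: fZE; exists B => //; rewrite setTI.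
split.
- move=> B mB; exists (f @^-1` B); last by rewrite setTI.
  by rewrite -[X in measurable X]setTI; exact: measurable_funPT.
- by apply/integrable_vecP => // i; case: (fZE i).
- by move=> _ [B mB <-] i; rewrite setTI; case: (fZE i) => _; exact.
Qed.

Lemma cond_expectation_ex : integrable_vec P X ->
  exists g, is_cond_expectation P X Z (g \o Z).
Proof.
move=> /(integrable_vecP _ (measurable_funPT X)) iX.
have [g gP] := choice (fun i => cond_exp_factor_ex Z (iX i)).
pose G x : n.-tuple R := [tuple g i x | i < n].
have mG : measurable_fun setT G.
  apply/measurable_fun_tnthP => i.
  rewrite (_ : _ \o _ = g i); last by apply/funext => x; rewrite /= tnth_mktuple.
  by case: (gP i).
exists (HB.pack G (isMeasurableFun.Build _ _ _ _ _ mG) : {mfun _ >-> _}).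
apply/is_cond_expectationP => i /=.
by under eq_fun do rewrite tnth_mktuple; case: (gP i).
Qed.

Lemma cond_expectation_uniq g Y :
  is_cond_expectation P X Z (g \o Z) -> is_cond_expectation P X Z Y ->
  {ae P, forall w, g (Z w) = Y w}.
Proof.
(* Almost sure equality is first proved for the restriction of P to sigma(Z). *)
move=> cg cY; pose TZ := g_sigma_algebra_preimageType Z.
have mZ := measurable_funPT Z.
have sub A : g_sigma_algebra_preimage Z A -> measurable A.
  by move=> [B mB <-]; exact: mZ.
(* The identity, seen as a map to the coarser sigma-algebra: its law under [P] is the restriction of
   [P] to the events of [Z]. There the coordinates of both versions are measurable and have equal
   integrals over every event. *)
pose emb : T -> TZ := id.
have memb : measurable_fun setT emb by move=> _ A mA; rewrite setTI; exact: sub.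
pose embf : {mfun T >-> TZ} :=
  HB.pack emb (isMeasurableFun.Build _ _ _ _ _ memb).
have main i : {ae P, forall w, tnth (g (Z w)) i = tnth (Y w) i}.
  pose F (V : T -> n.-tuple R) : TZ -> \bar R := fun w => (tnth (V w) i)%:E.
  have mF V : is_cond_expectation P X Z V ->
      measurable_fun (setT : set TZ) (F V).
    move=> cV; apply/measurable_EFinP.
    apply: (@measurable_tnth_comp _ TZ) => _ B mB; rewrite setTI.
    exact: (cond_exp_measurable cV).
  have iF V : is_cond_expectation P X Z V -> P.-integrable setT (F V \o emb).
    move=> cV; have := cond_exp_integrable cV.
    move/integrable_vecP; apply => _ B mB; rewrite setTI.
    exact/sub/(cond_exp_measurable cV).
  have mu_ae : ae_eq (distribution P embf) setT (F Y) (F (g \o Z)).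
    apply: integral_ae_eq => //.
    - by apply: integrable_pushforward => //; [exact: mF|exact: iF].
    - exact: mF.
    move=> A _ mA.
    have iFA V : is_cond_expectation P X Z V ->
        P.-integrable (emb @^-1` A) (F V \o emb).
      by move=> cV; apply: integrableS (iF _ cV) => //; exact: sub.
    rewrite (integral_pushforward memb (mF _ cY) (iFA _ cY) mA).
    rewrite (integral_pushforward memb (mF _ cg) (iFA _ cg) mA).
    have /= -> := cond_exp_integral cg mA i.
    by have /= -> := cond_exp_integral cY mA i.
  (* A null set of the restriction is an event of [Z], hence also a null event for [P]. *)
  case: mu_ae => N [mN N0 sN]; exists N; split => //; first exact: sub.
  move=> w gY; apply: sN => /= FYg; apply: gY; have [] := FYg I.
  exact: esym.
have {}main : {ae P, forall w i, tnth (g (Z w)) i = tnth (Y w) i}.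
  exact: filter_forall.
apply: filterS main => w gw; exact: eq_from_tnth.
Qed.

(** In each coordinate the error of [f] is [e - h(Z)], with [e] the error of [g] and [h] the
    difference of [f] and [g]. The Pythagorean identity applies because [e] integrates to zero over
    every event of [Z]. *)
Lemma mse_cond_expectation f g : integrable_vec P X ->
  is_cond_expectation P X Z (g \o Z) ->
  mse P X Z f = mse P X Z g +
    \sum_(i < n) \int[P]_w ((tnth (f (Z w)) i - tnth (g (Z w)) i) ^+ 2)%:E.
Proof.
move=> /(integrable_vecP _ (measurable_funPT X)) iX /is_cond_expectationP gP.
rewrite !mseE -big_split; apply: eq_bigr => i _ /=.
have [ig gE] := gP i; pose e w := (tnth (X w) i - tnth (g (Z w)) i)%R.
have ie : P.-integrable setT (fun w => (e w)%:E) :=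
  integrableB measurableT (iX i) ig.
have mfg : measurable_fun setT (fun x => tnth (f x) i - tnth (g x) i)%R.
  apply: measurable_funB; exact: measurable_tnth_comp.
rewrite -(integral_sqrB_comp (measurable_funPT Z) ie _ mfg).
  apply: eq_integral => w _; congr EFin; rewrite /e; ring.
move=> B mB; have mZB : measurable (Z @^-1` B).
  by rewrite -[_ @^-1` _]setTI; exact: measurable_funPT.
under eq_integral do rewrite EFinB.
rewrite integralB//; [|exact: integrableS (iX i)|exact: integrableS ig].
rewrite gE// subee// integrable_fin_num//; exact: integrableS (iX i).
Qed.

(** Turns a vanishing excess error into almost sure equality: a zero sum of nonnegative integrals
    has zero terms, a nonnegative function with zero integral vanishes almost everywhere, and the
    finitely many exceptional sets are joined. *)
Lemma sum_integral_sqr_eq0 f g :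
  \sum_(i < n) \int[P]_w ((tnth (f (Z w)) i - tnth (g (Z w)) i) ^+ 2)%:E = 0 <->
  {ae P, forall w, f (Z w) = g (Z w)}.
Proof.
have mfZ (h : {mfun n.-tuple R >-> n.-tuple R}) i :
    measurable_fun setT (fun w => tnth (h (Z w)) i).
  by apply: measurable_tnth_comp; exact: measurableT_comp.
pose D i w := ((tnth (f (Z w)) i - tnth (g (Z w)) i) ^+ 2)%:E.
have D0 i w : 0 <= D i w by rewrite lee_fin sqr_ge0.
have mD i : measurable_fun setT (D i).
  by apply/measurable_EFinP/measurable_funX/measurable_funB; exact: mfZ.
split=> [S0|fg].
- have fgi i : {ae P, forall w, tnth (f (Z w)) i = tnth (g (Z w)) i}.
    have : \int[P]_w D i w = 0.
      apply/eqP; rewrite eq_le integral_ge0// andbT -S0 (bigD1 i)//= leeDl//.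
      by apply: sume_ge0 => j _; apply: integral_ge0 => w _; exact: D0.
    move=> Di0; have : \int[P]_w `|D i w| = 0.
      by rewrite -[RHS]Di0; apply: eq_integral => w _; rewrite gee0_abs.
    move=> /(ae_eq_integral_abs P measurableT (mD i)); apply: filterS => w /(_ I).
    by move=> [] /eqP; rewrite sqrf_eq0 subr_eq0 => /eqP.
  have {}fgi : {ae P, forall w i, tnth (f (Z w)) i = tnth (g (Z w)) i}.
    exact: filter_forall.
  apply: filterS fgi => w fgw; exact: eq_from_tnth.
- apply: big1 => i _.
  transitivity (\int[P]_w cst 0 w); last exact: integral0.
  apply: ae_eq_integral => //; first exact: (mD i).
  by apply: filterS fg => w fgw _; rewrite /= fgw subrr expr0n.
Qed.

End mean_squared_error.

(** * Square-integrability of the Gaussian coordinates *)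

Lemma std_gaussian_coord_sqr_lty d (T : measurableType d) (R : realType)
    (P : probability T R) (n : nat) (eps : {RV P >-> n.-tuple R}) (i : 'I_n) :
  has_std_gaussian_law eps -> (\int[P]_w (tnth (eps w) i ^+ 2)%:E < +oo)%E.
Proof.
move=> geps; have mepsi : measurable_fun setT
    ((fun w => tnth (eps w) i) : T -> measurableTypeR R).
  exact: measurable_tnth_comp i (measurable_funPT eps).
pose epsi : {RV P >-> measurableTypeR R} := HB.pack (fun w => tnth (eps w) i)
   (isMeasurableFun.Build _ _ _ _ _ mepsi).
have lawE A : measurable A -> distribution P epsi A = normal_prob 0 1 A.
  (* The marginal is read off the rectangle that constrains only coordinate [i]; every other factor
     of the product is 1. *)
  move=> mA; pose B j := if j == i then A else setT.
  have mB j : measurable (B j) by rewrite /B; case: ifP.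
  have := geps B mB; rewrite (bigD1 i)//= big1 => [|j /negbTE ji]; last first.
    by rewrite /B ji probability_setT.
  rewrite mule1 {2}/B eqxx => <-; congr (P _); apply/seteqP; split=> w /=.
    by move=> Aw j; rewrite /B; case: eqP => // ->.
  by move=> /(_ i); rewrite /B eqxx.
have msqr : measurable_fun (setT : set (measurableTypeR R)) (fun x : R => (x ^+ 2)%:E).
  by apply/measurable_EFinP; exact: measurable_funX.
have <- : (\int[distribution P epsi]_x (x ^+ 2)%:E =
    \int[P]_w (tnth (eps w) i ^+ 2)%:E)%E.
  by rewrite ge0_integral_distribution// => x; rewrite lee_fin sqr_ge0.
rewrite (_ : integral _ _ _ = \int[normal_prob 0 1]_x (x ^+ 2)%:E)%E.
  exact: normal_prob01_sqr_lty.
by apply: eq_measure_integral => A mA _; exact: lawE.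
Qed.

(** * Optimality and uniqueness of the conditional expectation *)

Theorem proposition1 (R : realType) (disp : measure_display)
    (T : measurableType disp) (P : probability T R) (d : nat)
    (p_data : probability (d.-tuple R) R)
    (delta : R) (alpha sigma : R -> R)
    (x0 eps : {RV P >-> d.-tuple R}) (t : R)
    (hsched : vp_schedule delta alpha sigma)
    (hx0 : has_law x0 p_data)
    (hint : integrable_vec P x0)
    (heps : has_std_gaussian_law eps)
    (hindep : independent_RV x0 eps)
    (ht : 0 <= t <= 1)
    (halpha : alpha t != 0) :
  let xt := fun w : T => vec_comb (alpha t) (x0 w) (sigma t) (eps w) in
  let W := welfare P x0 xt in
  (forall xhat : {mfun d.-tuple R >-> d.-tuple R},
     maximizes W xhat <-> minimizes (mse P x0 xt) xhat) /\
  (exists xstar : {mfun d.-tuple R >-> d.-tuple R},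
     is_cond_expectation P x0 xt (xstar \o xt) /\ maximizes W xstar) /\
  (forall Y : T -> d.-tuple R, is_cond_expectation P x0 xt Y ->
     forall xhat : {mfun d.-tuple R >-> d.-tuple R},
       maximizes W xhat <-> {ae P, forall w, xhat (xt w) = Y w}).
Proof.
move=> xt W.
have mxt : measurable_fun setT xt.
  apply/measurable_fun_tnthP => i.
  rewrite (_ : _ \o _ = fun w =>
      alpha t * tnth (x0 w) i + sigma t * tnth (eps w) i).
    by apply: measurable_funD; apply: measurable_funM => //;
      exact: measurable_tnth_comp.
  by apply/funext => w; rewrite /= tnth_mktuple.
pose Z : {RV P >-> d.-tuple R} :=
  HB.pack xt (isMeasurableFun.Build _ _ _ _ _ mxt).
have maxP xhat : maximizes W xhat <-> minimizes (mse P x0 xt) xhat.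
  by split=> xhatP f; have := xhatP f; rewrite /W /welfare leeN2.
(* One version that is a measurable map of [xt] is fixed. An arbitrary version [Y] is compared with
   it only at the end, through almost sure uniqueness. *)
have [xstar cstar] := cond_expectation_ex Z hint.
have decomp f := mse_cond_expectation f hint cstar.
have excess_ge0 f : (0 <= \sum_(i < d)
    \int[P]_w ((tnth (f (Z w)) i - tnth (xstar (Z w)) i) ^+ 2)%:E)%E.
  by apply: sume_ge0 => i _; apply: integral_ge0 => w _; rewrite lee_fin sqr_ge0.
have minstar : minimizes (mse P x0 xt) xstar.
  by move=> f; rewrite (decomp f) leeDl.
have fin_mse : mse P x0 xt xstar \is a fin_num.
  pose l x : d.-tuple R := [tuple (alpha t)^-1 * tnth x i | i < d].
  have ml : measurable_fun setT l.
    apply/measurable_fun_tnthP => i.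
    rewrite (_ : _ \o _ = fun x => (alpha t)^-1 * tnth x i).
      by apply: measurable_funM => //; exact: measurable_tnth.
    by apply/funext => x; rewrite /= tnth_mktuple.
  pose lin : {mfun d.-tuple R >-> d.-tuple R} :=
    HB.pack l (isMeasurableFun.Build _ _ _ _ _ ml).
  rewrite ge0_fin_numE; last first.
    by rewrite /mse unlock integral_ge0// => w _; rewrite lee_fin sqr_ge0.
  apply: le_lt_trans (minstar lin) _; rewrite (mseE x0 Z).
  apply: lte_sum_pinfty => i _.
  (* Since [alpha t] is nonzero, [x0 - xt / alpha t] equals [- (sigma t / alpha t) eps]: the unknown
     [x0] cancels, and each squared coordinate is [c] times that of [eps]. *)
  pose c := (sigma t / alpha t) ^+ 2.
  rewrite (_ : integral _ _ _ = \int[P]_w (c%:E * (tnth (eps w) i ^+ 2)%:E))%E.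
    rewrite ge0_integralZl//.
    - by rewrite lte_mul_pinfty ?lee_fin ?sqr_ge0// std_gaussian_coord_sqr_lty.
    - apply/measurable_EFinP/measurable_funX; exact: measurable_tnth_comp.
    - by move=> w _; rewrite lee_fin sqr_ge0.
    - by rewrite lee_fin sqr_ge0.
  apply: eq_integral => w _; rewrite -EFinM /= !tnth_mktuple; congr EFin.
  by rewrite /c; field.
split=> //; split; first by exists xstar; split=> //; exact/maxP.
move=> Y cY xhat; have starY := cond_expectation_uniq cstar cY.
apply: (iff_trans (maxP xhat)); split=> [hatmin|hatY].
  have /sum_integral_sqr_eq0 : (\sum_(i < d)
      \int[P]_w ((tnth (xhat (Z w)) i - tnth (xstar (Z w)) i) ^+ 2)%:E = 0)%E.
    apply/eqP; rewrite eq_le excess_ge0 andbT.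
    have := hatmin xstar; rewrite (decomp xhat).
    (* The minimal error is cancelled from both sides, which is legitimate because it is finite. *)
    by rewrite -[leRHS]adde0 leeD2lE.
  move=> hatstar; apply: filterS2 hatstar starY => w /= <-; exact.
move=> f; apply: le_trans (minstar f); rewrite (decomp xhat).
rewrite (_ : \sum_(i < d) _ = 0)%E ?adde0//.
apply/sum_integral_sqr_eq0; apply: filterS2 hatY starY => w -> //.
Qed.
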